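(* With $\lambda^Q_{\max}(p_{tx},N_t)$, $\overline{p^G_{\max}}(p_{tx},N_E)$ and $C_{N_t}$ as defined in the context, let $$p_{tx}^*(N_E,N_t)=\arg\max_{p_{tx}\in[0,1]}\lambda^Q_{\max}(p_{tx},N_t)\quad\text{s.t.}\quad\overline{p^G_{\max}}(p_{tx},N_E)\le P^G,$$ let $\lambda^{Q*}_{\max}(N_E,N_t)=\lambda^Q_{\max}(p_{tx}^*,N_t)$ be the optimal value, and let $x^*(N_E)$ denote the solution $x$ of $\overline{p^G_{\max}}(x,N_E)=P^G$ for given $N_E>0$. Then $$p_{tx}^*(N_E,N_t)=\min\Big\{x^*(N_E),\,1,\,\frac{1}{C_{N_t}\lambda}\Big\}.$$ For any given $N_t\ge1$, $\lambda^{Q*}_{\max}(N_E,N_t)$ is strictly increasing in $N_E$ if $x^*(N_E)<\min\{1,\frac{1}{C_{N_t}\lambda}\}$ and is a constant for all $N_E$ if $x^*(N_E)\ge\min\{1,\frac{1}{C_{N_t}\lambda}\}$. For any given $N_E>0$, $\lambda^{Q*}_{\max}(N_E,N_t)$ is strictly increasing in $N_t$.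
   Context: Parameters: BS density $\lambda>0$, path loss exponent $\alpha>2$, distance $r_1>0$ of the mobile from its base station, SINR threshold $\delta>0$, noise power $N_0$, transmit power $P>0$, renewable energy arrival rate $\lambda^E<1$, energy storage size $N_E$ (a positive integer), number of antennas per base station (= cluster size) $N_t$ (a positive integer), grid power budget $P^G$. $\lambda^Q_{\max}(p_{tx},N_t)=p_{tx}\exp\big(-C_{N_t}p_{tx}\lambda-\frac{N_0}{P}\delta r_1^\alpha\big)$ is the maximum data arrival rate in the sufficient condition for queue stability when each BS with nonempty queue is active with probability $p_{tx}$, where - for $N_t=1$ (no coordination): $C_1=\frac{2}{\alpha-2}\pi r_1^2\delta$; - for $N_t>\frac\alpha2$: $C_{N_t}=\frac{2}{\alpha-2}\pi r_1^2\delta\,\min\Big\{1,\,r_1^{\alpha-2}\frac{(\lambda\pi)^{-1+\frac\alpha2}\Gamma(N_t-\frac\alpha2)}{\Gamma(N_t-1)}\Big\}$. $\overline{p^G_{\max}}(p_{tx},N_E)=(1-f(p_{tx},N_E))\,p_{tx}$ is the corresponding maximum average grid power cost per BS, where $f(p_{tx},N_E)=\frac{(\lambda^E/p_{tx})(1-(\lambda^E/p_{tx})^{N_E})}{1-(\lambda^E/p_{tx})^{N_E+1}}$ if $\lambda^E\ne p_{tx}$ and $f(p_{tx},N_E)=\frac{N_E}{N_E+1}$ if $\lambda^E=p_{tx}$.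
   Formalization: Strict increase in N_t fails when the min in C_{N_t} equals 1; proved instead: nondecreasing in N_t, strict from N_t to N_t' iff the second entry of the min for N_t' is below 1. N_t is 1 or exceeds α/2 (where C is defined); λ^E>0 and P^G>0 are assumed. *)

(* Defs.v *)
(* MathComp-Analysis *)
From mathcomp Require Import all_boot all_order all_algebra.
From mathcomp Require Import all_classical all_reals all_analysis.

Set Implicit Arguments.
Unset Strict Implicit.
Unset Printing Implicit Defensive.

Import Order.TTheory GRing.Theory Num.Theory.
Import numFieldNormedType.Exports.

Local Open Scope classical_set_scope.
Local Open Scope ring_scope.

(* Euler's Gamma function, as the Lebesgue integral; the integral converges
   for [0 < s] only. *)
Definition Gamma (R : realType) (s : R) : R :=
  \int[lebesgue_measure]_(t in `]0, +oo[) (t `^ (s - 1) * expR (- t)).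

Record network (R : realType) := Network {
  lambda : R;   (* density of the base stations *)
  alpha : R;    (* path loss exponent *)
  r1 : R;       (* distance from the mobile to its base station *)
  delta : R;    (* SINR threshold *)
  N0 : R;       (* noise power *)
  Ptx : R;      (* transmit power *)
  lambdaE : R;  (* renewable energy arrival rate *)
  PG : R        (* grid power budget *)
}.

Section network_quantities.
Variables (R : realType) (S : network R).
Implicit Types (p x : R) (NE Nt : nat).

(* The interference constant is given only for one antenna and for more than
   [alpha / 2] antennas. *)
Definition admissible Nt : Prop := Nt = 1%N \/ alpha S / 2 < Nt%:R.

Definition coord_factor Nt : R :=
  r1 S `^ (alpha S - 2) *
  ((lambda S * pi) `^ (-1 + alpha S / 2) * Gamma (Nt%:R - alpha S / 2)
    / Gamma (Nt%:R - 1)).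

(* As [2 < alpha], [Nt = 1] and [alpha / 2 < Nt] are mutually exclusive; the
   value is junk when [Nt] is not admissible. *)
Definition C Nt : R :=
  2 / (alpha S - 2) * pi * r1 S ^+ 2 * delta S *
  (if Nt == 1%N then 1 else Num.min 1 (coord_factor Nt)).

Definition lambdaQmax p Nt : R :=
  p * expR (- C Nt * p * lambda S - N0 S / Ptx S * delta S * r1 S `^ alpha S).

Definition f p NE : R :=
  if lambdaE S == p then NE%:R / NE.+1%:R
  else lambdaE S / p * (1 - (lambdaE S / p) ^+ NE)
         / (1 - (lambdaE S / p) ^+ NE.+1).

(* At [p = 0] the quotient [lambdaE / p] is 0 by convention, so that
   [pGmax 0 NE = 0], which is also the limit of [pGmax p NE] as p tends to 0
   from the right. *)
Definition pGmax p NE : R := (1 - f p NE) * p.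

Definition feasible NE p : Prop := [/\ 0 <= p, p <= 1 & pGmax p NE <= PG S].

Definition maximizers NE Nt : set R :=
  [set p | feasible NE p /\
           forall q, feasible NE q -> lambdaQmax q Nt <= lambdaQmax p Nt].

Definition grid_solutions NE : set R := [set x | 0 < x /\ pGmax x NE = PG S].

(* [get A] is a chosen element of [A], junk when [A] is empty. *)
Definition ptx_star NE Nt : R := get (maximizers NE Nt).

Definition x_star NE : R := get (grid_solutions NE).

Definition lambdaQmax_star NE Nt : R := lambdaQmax (ptx_star NE Nt) Nt.

End network_quantities.

(* Main.v *)
(* For [x > 0] the grid cost is [pGmax x NE = x / \sum_(i <= NE) (lambdaE / x)^i],
   which increases strictly with [x] and decreases strictly with [NE]. Hence
   [x_star] is unique and increases with [NE], and the feasible set is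
   [[0, min 1 x_star]]. On it [p * expR (- C lambda p)] has its only maximum at
   the point closest to [1 / (C lambda)], because [1 + y < expR y] for
   [y != 0]. The optimal value decreases strictly with [C], and
   [Gamma (s + 1) = s * Gamma s] gives
   [coord_factor (Nt + 1) / coord_factor Nt = (Nt - alpha / 2) / (Nt - 1) < 1],
   so [C] decreases with [Nt], strictly as soon as the factor drops below 1. *)
Require Import Defs.
From mathcomp Require Import all_boot all_order all_algebra.
From mathcomp Require Import all_classical all_reals all_analysis.
From mathcomp Require Import measurable_realfun ring.

Set Implicit Arguments.
Unset Strict Implicit.
Unset Printing Implicit Defensive.

Import Order.TTheory GRing.Theory Num.Theory.
Import numFieldNormedType.Exports.

Local Open Scope classical_set_scope.
Local Open Scope ring_scope.

(** * The Gamma integral: recursion, finiteness and positivity *)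

Section Gamma_function.
Context {R : realType}.
Implicit Types (s t a b : R).
Local Notation mu := (@lebesgue_measure R).

Definition gamma_fun s t : R := t `^ (s - 1) * expR (- t).

Lemma gamma_fun_ge0 s t : 0 <= gamma_fun s t.
Proof. by rewrite mulr_ge0 ?powR_ge0 ?expR_ge0. Qed.

Lemma measurable_gamma_fun s (D : set R) :
  measurable_fun D (EFin \o gamma_fun s).
Proof.
apply/measurable_EFinP/measurable_funTS; apply: measurable_funM.
  exact: measurable_powR.
by apply: measurableT_comp => //; exact: oppr_measurable.
Qed.

Lemma is_derive_expRN t : is_derive t 1 (fun t => - expR (- t)) (expR (- t)).
Proof. by apply: is_derive_eq; rewrite mulrN1 opprK. Qed.

Lemma continuous_powR s t : 0 < t -> {for t, continuous (fun t => t `^ s)}.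
Proof.
move=> t0; apply/differentiable_continuous/derivable1_diffP.
by apply: derivable_powR; rewrite in_itv/= t0.
Qed.

Lemma continuous_gamma_fun s t : 0 < t -> {for t, continuous (gamma_fun s)}.
Proof.
move=> t0; apply: cvgM; first exact: continuous_powR.
apply: (@continuous_comp _ _ _ -%R expR); first exact: opp_continuous.
exact: continuous_expR.
Qed.

(** The segment stays away from 0, where the powers of [t] may be singular, so all functions
    involved are continuous on it. The antiderivative of [expR (- t)] is [- expR (- t)]. *)
Lemma integral_gamma_fun_by_parts s a b : 0 < a -> a < b ->
  (\int[mu]_(t in `[a, b]) (gamma_fun (s + 1) t)%:E =
   (a `^ s * expR (- a) - b `^ s * expR (- b))%:E +
   s%:E * \int[mu]_(t in `[a, b]) (gamma_fun s t)%:E)%E.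
Proof.
move=> a0 ab.
have pos t : t \in `[a, b] -> 0 < t.
  by rewrite in_itv/= => /andP[at_ _]; exact: lt_le_trans at_.
have poso t : t \in `]a, b[ -> 0 < t.
  by rewrite in_itv/= => /andP[at_ _]; exact: lt_trans at_.
have cw (h : R -> R) : (forall t, 0 < t -> {for t, continuous h}) ->
    {within `[a, b], continuous h}.
  move=> ch; apply: continuous_in_subspaceT => t /set_mem /= tab.
  exact/ch/pos.
have dP t : 0 < t -> is_derive t 1 (fun t => t `^ s) (s * t `^ (s - 1)).
  exact: is_derive1_powR.
have cE t : {for t, continuous (fun t => expR (- t))}.
  apply: (@continuous_comp _ _ _ -%R expR); first exact: opp_continuous.
  exact: continuous_expR.
have int_gamma : mu.-integrable `[a, b] (EFin \o gamma_fun s).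
  apply: continuous_compact_integrable; first exact: segment_compact.
  by apply: cw; exact: continuous_gamma_fun.
have := @integration_by_parts R (fun t => t `^ s) (fun t => - expR (- t))
  (fun t => s * t `^ (s - 1)) (fun t => expR (- t)) a b ab.
rewrite /gamma_fun addrK => ->.
- under [X in (_ - X)%E]eq_integral => t _.
    rewrite (_ : _ * _ = - s * gamma_fun s t); last by rewrite /gamma_fun; ring.
    rewrite EFinM; over.
  rewrite integralZl// EFinN mulNe oppeK; congr (_%:E + _)%E; ring.
- by apply: cw => t t0; apply: cvgM; [exact: cvg_cst|exact: continuous_powR].
- split.
  + by move=> t /poso/dP[].
  + by apply: cvg_at_right_filter; apply: continuous_powR.
  + by apply: cvg_at_left_filter; apply: continuous_powR; exact: lt_trans ab.
- by move=> t /poso/dP[_ /= <-]; rewrite derive1E.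
- by apply: cw => t _; exact: cE.
- split.
  + by move=> t _; have [] := is_derive_expRN t.
  + by apply: cvg_at_right_filter; apply: cvgN; exact: cE.
  + by apply: cvg_at_left_filter; apply: cvgN; exact: cE.
- by move=> t _; have [_ <-] := is_derive_expRN t; rewrite derive1E.
Qed.

(** Monotone convergence for a nonnegative integrand on segments growing to the half-line. The shift
    by 2 keeps even the segment at [n = 0] nondegenerate. *)
Lemma cvg_integral_gamma_fun s :
  (\int[mu]_(t in `[(n.+2%:R^-1)%R, n.+2%:R%R]) (gamma_fun s t)%:E
     @[n --> \oo] -->
   \int[mu]_(t in `]0%R, +oo[) (gamma_fun s t)%:E)%E.
Proof.
have -> : `]0, +oo[%classic =
    \bigcup_n `[n.+2%:R^-1, n.+2%:R]%classic :> set R.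
  apply/seteqP; split => t /=.
    rewrite in_itv/= andbT => t0.
    have [n nlt] : exists n : nat, Num.max t t^-1 < n%:R.
      exists (Num.trunc (Num.max t t^-1)).+1.
      exact: truncnS_gt.
    exists n => //=; rewrite in_itv/=.
    have n2 : (n%:R : R) <= n.+2%:R by rewrite ler_nat leqW.
    move: nlt; rewrite gt_max => /andP[tn tVn].
    rewrite (le_trans (ltW tn) n2) andbT invf_ple ?posrE//.
    exact: le_trans (ltW tVn) n2.
  move=> [n _] /=; rewrite !in_itv/= andbT => /andP[+ _].
  by apply: lt_le_trans; rewrite invr_gt0 ltr0n.
apply: ge0_nondecreasing_set_cvg_integral => //.
- apply/nondecreasing_seqP => n; apply/subsetPset => t /=.
  rewrite !in_itv/= => /andP[nt tn]; apply/andP; split.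
    by apply: le_trans nt; rewrite lef_pV2 ?posrE// ler_nat.
  by apply: (le_trans tn); rewrite ler_nat.
- by move=> n; exact: measurable_gamma_fun.
- by move=> n t _; rewrite lee_fin gamma_fun_ge0.
Qed.

Local Notation G s := (\int[mu]_(t in `]0%R, +oo[) (gamma_fun s t)%:E)%E.

(** With an integer [k >= s], the exponential series gives [expR x >= x ^+ k.+1 / k.+1!], so the
    product is at most [k.+1! / x]. *)
Lemma cvg_powR_expRN_infty s :
  (n.+2%:R : R) `^ s * expR (- n.+2%:R) @[n --> \oo] --> 0.
Proof.
pose k := (Num.trunc `|s|).+1.
have sk : s <= k%:R.
  by apply: le_trans (ler_norm s) _; apply/ltW/truncnS_gt.
pose K : R := k.+1`!%:R.
have K0 : 0 < K by rewrite ltr0n fact_gt0.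
apply: (@squeeze_cvgr _ _ _ _ (fun=> 0) (fun n => K * (n.+1%:R)^-1)).
- apply: nearW => n; rewrite mulr_ge0 ?powR_ge0 ?expR_ge0//=.
  have x0 : (0 : R) < n.+2%:R by rewrite ltr0n.
  rewrite expRN ler_pdivrMr ?expR_gt0//.
  apply: (@le_trans _ _ (n.+2%:R ^+ k)).
    by rewrite -powR_mulrn ?(ltW x0)//; apply: ler_powR => //; rewrite ler1n.
  apply: (@le_trans _ _ (K * n.+2%:R^-1 * (n.+2%:R ^+ k.+1 / K))).
    set x := n.+2%:R in x0 *.
    suff -> : K / x * (x ^+ k.+1 / K) = x ^+ k by [].
    by rewrite exprS; field; rewrite !gt_eqF.
  apply: ler_pM.
  + by rewrite mulr_ge0 ?invr_ge0 ?ltW.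
  + by rewrite divr_ge0 ?exprn_ge0 ?ltW.
  + by rewrite ler_pM2l// lef_pV2 ?posrE// ler_nat.
  + by apply: le_trans (expR_ge1Dxn k (ltW x0)); rewrite lerDr.
- exact: cvg_cst.
- rewrite -[X in _ --> X](mulr0 K).
  by apply: cvgM; [exact: cvg_cst|exact: cvg_harmonic].
Qed.

Lemma cvg_powR_expRN_0 s : 0 < s ->
  (n.+2%:R^-1 : R) `^ s * expR (- n.+2%:R^-1) @[n --> \oo] --> 0.
Proof.
move=> s0.
have h0 : ((n.+2%:R)^-1 : R) @[n --> \oo] --> 0.
  by rewrite (cvg_shiftS (fun n => (n.+1%:R : R)^-1)); exact: cvg_harmonic.
apply: (@squeeze_cvgr _ _ _ _ (fun=> 0) (fun n => (n.+2%:R^-1 : R) `^ s)).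
- apply: nearW => n; rewrite mulr_ge0 ?powR_ge0 ?expR_ge0//=.
  by rewrite ler_piMr ?powR_ge0// expR_le1 oppr_le0 invr_ge0.
- exact: cvg_cst.
- have /cvg_at_rightP := powR_cvg0 s0; apply.
  by split=> // n; rewrite invr_gt0 ltr0n.
Qed.

(* Integration by parts on [1/n, n] passes to the limit in the extended reals,
   so the recursion is available before finiteness and serves to prove it. *)
Lemma integral_gamma_funS s : 0 < s -> (G (s + 1) = s%:E * G s)%E.
Proof.
move=> s0; have h1 := @cvg_integral_gamma_fun (s + 1).
have lim0 : (((n.+2%:R^-1 : R) `^ s * expR (- n.+2%:R^-1) -
    (n.+2%:R : R) `^ s * expR (- n.+2%:R))%:E @[n --> \oo] --> 0%:E)%E.
  apply: cvg_EFin; first exact: nearW.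
  rewrite -[X in _ --> X](subr0 0).
  by apply: cvgB; [exact: cvg_powR_expRN_0|exact: cvg_powR_expRN_infty].
rewrite -(cvg_lim _ h1)// -[RHS]add0e; apply/cvg_lim => //.
have bp n : (n.+2%:R^-1 : R) < n.+2%:R.
  by rewrite (@lt_trans _ _ 1) ?ltr1n// invf_lt1 ?ltr1n.
under eq_cvg => n do rewrite integral_gamma_fun_by_parts ?invr_gt0//.
apply: cvgeD lim0 _; first exact: fin_num_adde_defr.
by apply: cvgeZl => //; exact: cvg_integral_gamma_fun.
Qed.

Lemma integral_gamma_fun_ge0 s : (0 <= G s)%E.
Proof. by apply: integral_ge0 => t _; rewrite lee_fin gamma_fun_ge0. Qed.

(** For [s = 1] the integrand is the exponential density of rate 1, whose total mass is 1. *)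
Lemma integral_gamma_fun1_lty : (G 1 < +oo)%E.
Proof.
apply: (@le_lt_trans _ _ (\int[mu]_t (exponential_pdf 1 t)%:E)%E); last first.
  by rewrite integral_exponential_pdf// ltry.
have mE : measurable_fun [set: R] (EFin \o exponential_pdf (1 : R)).
  by apply/measurable_EFinP; exact: measurable_exponential_pdf.
apply: (@le_trans _ _ (\int[mu]_(t in `]0%R, +oo[) (exponential_pdf 1 t)%:E)%E).
  apply: ge0_le_integral => //.
  - by move=> t _; rewrite lee_fin gamma_fun_ge0.
  - exact: measurable_gamma_fun.
  - exact: measurable_funTS.
  - move=> t /=; rewrite in_itv/= andbT => t0.
    rewrite exponential_pdfE ?(ltW t0)// /gamma_fun subrr powRr0.
    by rewrite lee_fin mulN1r.
apply: ge0_subset_integral => //.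
by move=> t _; rewrite lee_fin exponential_pdf_ge0.
Qed.

Lemma integral_gamma_fun_nat_lty n : (G n.+1%:R < +oo)%E.
Proof.
elim: n => [|n IHn]; first exact: integral_gamma_fun1_lty.
by rewrite -natr1 integral_gamma_funS// lte_mul_pinfty.
Qed.

(** For [n >= s], [t ^ (s - 1)] is at most 1 when [t <= 1] and at most [t ^ n] when [t >= 1]; hence
    it is always below [1 + t ^ n]. *)
Lemma integral_gamma_fun_ge1_lty s : 1 <= s -> (G s < +oo)%E.
Proof.
move=> s1; pose n := (Num.trunc s).+1.
have sn : s <= n%:R by apply/ltW/truncnS_gt.
apply: (@le_lt_trans _ _ (G 1 + G n.+1%:R)%E); last first.
  by rewrite lte_add_pinfty ?integral_gamma_fun1_lty ?integral_gamma_fun_nat_lty.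
rewrite -ge0_integralD//=; last 4 first.
- by move=> t _; rewrite lee_fin gamma_fun_ge0.
- exact: measurable_gamma_fun.
- by move=> t _; rewrite lee_fin gamma_fun_ge0.
- exact: measurable_gamma_fun.
apply: ge0_le_integral => //.
- by move=> t _; rewrite lee_fin gamma_fun_ge0.
- exact: measurable_gamma_fun.
- by apply: emeasurable_funD; exact: measurable_gamma_fun.
move=> t /=; rewrite in_itv/= andbT => t0.
rewrite -EFinD lee_fin /gamma_fun -mulrDl ler_wpM2r ?expR_ge0//.
rewrite subrr powRr0 -natr1 addrK; have [t1|/ltW t1] := leP t 1.
  rewrite (@le_trans _ _ 1)// ?lerDl ?powR_ge0//.
  rewrite -[leRHS](powRr0 t); apply: ger_powR; first by rewrite t0.
  by rewrite subr_ge0.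
apply: (@le_trans _ _ (t `^ n%:R)); last by rewrite lerDr.
by apply: ler_powR => //; rewrite lerBlDr (le_trans sn)// lerDl.
Qed.

(** The recursion carries finiteness down from [s + 1]: were [G s] infinite, so would be
    [s * G s]. *)
Lemma integral_gamma_fun_lty s : 0 < s -> (G s < +oo)%E.
Proof.
move=> s0; have := @integral_gamma_fun_ge1_lty (s + 1).
rewrite lerDr (ltW s0) => /(_ isT); rewrite integral_gamma_funS//.
rewrite !ltey; apply: contra => /eqP ->.
by rewrite gt0_muley ?lte_fin.
Qed.

Lemma GammaS s : 0 < s -> Gamma (s + 1) = s * Gamma s.
Proof.
move=> s0; rewrite /Gamma /Rintegral integral_gamma_funS// fineM//.
by rewrite ge0_fin_numE ?integral_gamma_fun_lty ?integral_gamma_fun_ge0.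
Qed.

(** On [[1, 2]] the power is at least 1 and the exponential at least [expR (-2)]. *)
Lemma Gamma_ge1_gt0 s : 1 <= s -> 0 < Gamma s.
Proof.
move=> s1; have s0 : 0 < s by exact: lt_le_trans s1.
rewrite /Gamma /Rintegral -lte_fin fineK; last first.
  by rewrite ge0_fin_numE ?integral_gamma_fun_lty ?integral_gamma_fun_ge0.
apply: (@lt_le_trans _ _ (\int[mu]_(t in `[1%R, 2%R]) (expR (-2))%:E)%E).
  rewrite integral_cst//= lebesgue_measure_itv/= lte_fin ltr1n.
  by rewrite -EFinB -EFinM lte_fin mulr_gt0 ?expR_gt0// subr_gt0 ltr1n.
apply: (@le_trans _ _ (\int[mu]_(t in `[1%R, 2%R]) (gamma_fun s t)%:E)%E).
  apply: ge0_le_integral => //.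
  - exact: measurable_gamma_fun.
  - move=> t /=; rewrite in_itv/= => /andP[t1 t2].
    rewrite lee_fin /gamma_fun -[leLHS]mul1r.
    apply: ler_pM => //; rewrite ?expR_ge0 ?ler_expR ?lerN2//.
    by rewrite -[leLHS](powRr0 t); apply: ler_powR => //; rewrite subr_ge0.
apply: ge0_subset_integral => //.
- exact: measurable_gamma_fun.
- by move=> t _; rewrite lee_fin gamma_fun_ge0.
- move=> t /=; rewrite !in_itv/= andbT => /andP[t1 _].
  exact: lt_le_trans t1.
Qed.

Lemma Gamma_gt0 s : 0 < s -> 0 < Gamma s.
Proof.
move=> s0; rewrite -(pmulr_rgt0 _ s0) -GammaS//.
by apply: Gamma_ge1_gt0; rewrite lerDr ltW.
Qed.

End Gamma_function.

(** * Monotonicity of the interference constant in the cluster size *)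

Section coordination.
Context {R : realType} {S : network R}.
Hypotheses (lambda_gt0 : 0 < lambda S) (alpha_gt2 : 2 < alpha S)
  (r1_gt0 : 0 < r1 S) (delta_gt0 : 0 < delta S).
Implicit Types Nt : nat.
Local Notation a := (alpha S / 2).

Let a_gt1 : 1 < a. Proof. by rewrite ltr_pdivlMr// mul1r. Qed.

Lemma coord_factor_gt0 Nt : a < Nt%:R -> 0 < coord_factor S Nt.
Proof.
move=> aN; have N1 : 1 < Nt%:R :> R by exact: lt_trans aN.
rewrite /coord_factor mulr_gt0 ?powR_gt0// divr_gt0 ?Gamma_gt0 ?subr_gt0//.
by rewrite mulr_gt0 ?powR_gt0 ?mulr_gt0 ?pi_gt0// Gamma_gt0// subr_gt0.
Qed.

Lemma coord_factor_ltS Nt : a < Nt%:R ->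
  coord_factor S Nt.+1 < coord_factor S Nt.
Proof.
move=> aN; have N1 : 1 < Nt%:R :> R by exact: lt_trans aN.
have cf0 := coord_factor_gt0 aN.
have -> : coord_factor S Nt.+1 =
    coord_factor S Nt * ((Nt%:R - a) / (Nt%:R - 1)).
  rewrite /coord_factor -[Nt.+1%:R]natr1.
  have -> : Nt%:R + 1 - a = Nt%:R - a + 1 by ring.
  have -> : Nt%:R + 1 - 1 = Nt%:R - 1 + 1 :> R by ring.
  rewrite !GammaS ?subr_gt0//.
  have G0 : Gamma (Nt%:R - 1) != 0 :> R by rewrite gt_eqF// Gamma_gt0// subr_gt0.
  (* The Gamma values are generalized so that [field] treats them as atoms. *)
  move: (Gamma (Nt%:R - 1)) G0 (Gamma (Nt%:R - a)) => G1 G1_neq0 Ga.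
  by field; rewrite G1_neq0 gt_eqF// subr_gt0.
rewrite gtr_pMr// ltr_pdivrMr ?subr_gt0// mul1r.
by rewrite ltrD2l ltrN2.
Qed.

Lemma coord_factor_lt Nt Nt' : a < Nt%:R -> (Nt < Nt')%N ->
  coord_factor S Nt' < coord_factor S Nt.
Proof.
move=> aN; elim: Nt' => // Nt' IH; rewrite ltnS leq_eqVlt => /predU1P[<-|NN].
  exact: coord_factor_ltS.
apply: lt_trans (IH NN); apply: coord_factor_ltS.
by apply: lt_trans aN _; rewrite ltr_nat.
Qed.

(* Keeps unification from comparing Gamma integrals. *)
Local Opaque coord_factor.

(** The only factor of [C] that depends on [Nt]; the other one is a positive constant. *)
Definition coord_gain Nt : R :=
  if Nt == 1%N then 1 else Num.min 1 (coord_factor S Nt).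

Lemma C_coord_gain Nt :
  C S Nt = 2 / (alpha S - 2) * pi * r1 S ^+ 2 * delta S * coord_gain Nt.
Proof. by []. Qed.

Let K_gt0 : 0 < 2 / (alpha S - 2) * pi * r1 S ^+ 2 * delta S.
Proof.
by rewrite mulr_gt0// mulr_gt0 ?exprn_gt0// mulr_gt0 ?pi_gt0// divr_gt0 ?subr_gt0.
Qed.

Lemma C_gt0 Nt : admissible S Nt -> 0 < C S Nt.
Proof.
move=> adN; rewrite C_coord_gain mulr_gt0// /coord_gain.
case: eqP => // N1; case: adN => // aN.
by rewrite lt_min ltr01 coord_factor_gt0.
Qed.

(** [Nt'] exceeds 1, so its gain is its factor, below the cap 1. The gain of [Nt] is 1 or the
    minimum of 1 and a larger factor. *)
Lemma coord_gain_lt Nt Nt' : admissible S Nt -> admissible S Nt' ->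
  (Nt < Nt')%N -> coord_factor S Nt' < 1 -> coord_gain Nt' < coord_gain Nt.
Proof.
move=> adN adN' NN cf1; have N'1 : (Nt' == 1%N) = false.
  case: adN => [N1|aN]; first by rewrite gtn_eqF// -N1.
  apply/gtn_eqF/(leq_ltn_trans _ NN).
  by rewrite -(ltr_nat R) (lt_trans _ aN)// (lt_trans ltr01).
have -> : coord_gain Nt' = coord_factor S Nt'.
  by rewrite /coord_gain N'1; apply/min_idPr/ltW.
rewrite /coord_gain; case: eqP => // N1.
by case: adN => // aN; rewrite lt_min cf1 coord_factor_lt.
Qed.

(** Factors decrease with the cluster size, so if the later one reaches the cap, both gains equal
    1. *)
Lemma coord_gain_eq Nt Nt' : admissible S Nt -> (Nt < Nt')%N ->
  1 <= coord_factor S Nt' -> coord_gain Nt = coord_gain Nt'.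
Proof.
move=> adN NN cf1; have -> : coord_gain Nt' = 1.
  by rewrite /coord_gain; case: eqP => // _; apply/min_idPl.
rewrite /coord_gain; case: eqP => // N1; case: adN => // aN.
by apply/min_idPl/(le_trans cf1)/ltW/coord_factor_lt.
Qed.

Local Opaque C coord_gain.

Lemma C_lt Nt Nt' : admissible S Nt -> admissible S Nt' -> (Nt < Nt')%N ->
  coord_factor S Nt' < 1 -> C S Nt' < C S Nt.
Proof.
move=> adN adN' NN cf1.
by rewrite 2!C_coord_gain ltr_pM2l// coord_gain_lt.
Qed.

Lemma C_eq Nt Nt' : admissible S Nt -> (Nt < Nt')%N ->
  1 <= coord_factor S Nt' -> C S Nt = C S Nt'.
Proof.
by move=> adN NN cf1; rewrite 2!C_coord_gain (coord_gain_eq adN NN cf1).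
Qed.

End coordination.

Local Opaque C coord_factor.

(** * Inequalities for [p * expR (- (k * p))] *)

Section linear_exponential.
Context {R : realType}.
Implicit Types (k p q : R).

(* The hypothesis is the tangent bound [p / q <= 1 + k * (p - q)]; it holds
   for every [p] when [q = 1 / k], and for [p <= q] when [q <= 1 / k]. *)
Lemma ltr_mulr_expRN k p q : 0 < k -> 0 < q -> p != q ->
  p <= q + q * k * (p - q) -> p * expR (- (k * p)) < q * expR (- (k * q)).
Proof.
move=> k0 q0 pq pleq.
have kpq : k * (p - q) != 0 by rewrite mulf_neq0 ?subr_eq0// gt_eqF.
have -> : - (k * q) = k * (p - q) + - (k * p) by ring.
rewrite expRD mulrA ltr_pM2r ?expR_gt0//.
apply: le_lt_trans pleq _.
have -> : q + q * k * (p - q) = q * (1 + k * (p - q)) by ring.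
by rewrite ltr_pM2l// expR_gt1Dx.
Qed.

(** Shaped like the body of [lambdaQmax], to compare two values of [C] at the same activity
    probability. *)
Lemma ltr_mulr_expRB p q z k k' : 0 < p -> 0 < q -> k' < k ->
  p * expR (- k * p * q - z) < p * expR (- k' * p * q - z).
Proof.
move=> p0 q0 kk; rewrite ltr_pM2l// ltr_expR ltrD2r !mulNr ltrN2.
by rewrite !ltr_pM2r.
Qed.

End linear_exponential.

(** * The grid cost, its inverse and the feasible set *)

Section grid_power.
Context {R : realType} {S : network R}.
Hypotheses (lambdaE_gt0 : 0 < lambdaE S) (PG_gt0 : 0 < PG S).
Implicit Types (p x : R) (NE : nat).
Local Notation e := (lambdaE S).

(** The reciprocal of [1 - f]; as a sum it covers both cases of [f] at once and shows its
    monotonicity. *)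
Definition geometric_load NE p : R := \sum_(i < NE.+1) (e / p) ^+ i.

Lemma geometric_load_ge1 NE p : 0 < p -> 1 <= geometric_load NE p.
Proof.
move=> p0; rewrite /geometric_load big_ord_recl expr0 lerDl sumr_ge0// => i _.
by rewrite exprn_ge0// divr_ge0// ltW.
Qed.

(** With [r = e / p] different from 1, [1 - f = (1 - r) / (1 - r ^+ NE.+1)], the inverse of a
    geometric sum; for [r = 1] the sum is [NE.+1]. *)
Lemma pGmaxE NE p : 0 < p -> pGmax S p NE = p / geometric_load NE p.
Proof.
move=> p0; rewrite /pGmax mulrC; congr (_ * _); rewrite /f.
have L0 : geometric_load NE p != 0.
  by rewrite gt_eqF// (lt_le_trans ltr01)// geometric_load_ge1.
case: eqVneq => [ep|ep].
  have -> : geometric_load NE p = NE.+1%:R.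
    rewrite /geometric_load ep divff ?gt_eqF//.
    under eq_bigr do rewrite expr1n.
    by rewrite sumr_const card_ord.
  by rewrite -natr1; field; rewrite natr1 pnatr_eq0.
have r1 : 1 - e / p != 0.
  apply: contra ep; rewrite subr_eq0 => /eqP r1.
  by rewrite -[p]mul1r r1 divfK// gt_eqF.
have LE : 1 - (e / p) ^+ NE.+1 = (1 - e / p) * geometric_load NE p.
  by rewrite -[in LHS](expr1n _ NE.+1) subrXX; congr (_ * _);
    apply: eq_bigr => i _; rewrite expr1n mul1r.
rewrite -[geometric_load NE p](mulKf r1) -LE.
have d0 : 1 - (e / p) ^+ NE.+1 != 0 by rewrite LE mulf_neq0.
have -> : (e / p) ^+ NE.+1 = e / p * (e / p) ^+ NE by rewrite exprS.
rewrite exprS in d0.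
set r := e / p in r1 d0 *; set z := r ^+ NE in d0 *.
by field; rewrite d0 r1.
Qed.

Lemma pGmax0 NE : pGmax S 0 NE = 0. Proof. by rewrite /pGmax mulr0. Qed.

(** The numerator grows strictly, and the load, a polynomial in [e / p] with nonnegative
    coefficients, does not grow. *)
Lemma ltr_pGmax NE p q : 0 < p -> p < q -> pGmax S p NE < pGmax S q NE.
Proof.
move=> p0 pq; have q0 := lt_trans p0 pq.
have [Lp Lq] : 0 < geometric_load NE p /\ 0 < geometric_load NE q.
  by split; apply: lt_le_trans ltr01 _; exact: geometric_load_ge1.
have Lqp : geometric_load NE q <= geometric_load NE p.
  apply: ler_sum => i _; apply: lerXn2r; rewrite ?nnegrE ?divr_ge0 ?ltW//.
  by rewrite ltr_pM2l// ltf_pV2.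
rewrite !pGmaxE// ltr_pdivrMr// mulrAC ltr_pdivlMr//.
apply: (@le_lt_trans _ _ (p * geometric_load NE p)).
  by rewrite ler_pM2l.
by rewrite ltr_pM2r.
Qed.

Lemma ler_pGmax NE p q : 0 < p -> 0 < q ->
  (pGmax S p NE <= pGmax S q NE) = (p <= q).
Proof.
move=> p0 q0; case: (ltgtP p q) => [pq|qp|->]; last exact: lexx.
  by rewrite ltW// ltr_pGmax.
by apply/negbTE; rewrite -ltNge ltr_pGmax.
Qed.

Lemma pGmax_inj NE p q : 0 < p -> 0 < q ->
  pGmax S p NE = pGmax S q NE -> p = q.
Proof.
move=> p0 q0 pq; apply/le_anti.
by rewrite -(ler_pGmax NE p0 q0) -(ler_pGmax NE q0 p0) pq lexx.
Qed.

Lemma geometric_load_lt NE NE' p : 0 < p -> (NE < NE')%N ->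
  geometric_load NE p < geometric_load NE' p.
Proof.
move=> p0.
suff : {homo geometric_load^~ p : m n / (m < n)%N >-> m < n} by exact.
apply: homo_ltn => [? ? ?|n]; first exact: lt_trans.
by rewrite [ltRHS]big_ord_recr/= ltrDl exprn_gt0// divr_gt0.
Qed.

Lemma pGmax_lt_storage NE NE' p : 0 < p -> (NE < NE')%N ->
  pGmax S p NE' < pGmax S p NE.
Proof.
move=> p0 NN; rewrite !pGmaxE// ltr_pM2l// ltf_pV2 ?posrE.
- exact: geometric_load_lt.
- exact: lt_le_trans ltr01 (geometric_load_ge1 _ p0).
- exact: lt_le_trans ltr01 (geometric_load_ge1 _ p0).
Qed.

(** Clearing denominators allows the intermediate value theorem for polynomials. The search interval
    starts at [PG > 0], which excludes the spurious root 0. *)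
Lemma pGmax_eq_PG_solvable NE : exists2 x, 0 < x & pGmax S x NE = PG S.
Proof.
(* [x ^+ NE * (x - PG * geometric_load NE x)] is a polynomial in [x]. *)
pose P : {poly R} :=
  'X^(NE.+1) - PG S *: \sum_(i < NE.+1) e ^+ i *: 'X^(NE - i).
have PE x : 0 < x -> P.[x] = x ^+ NE * (x - PG S * geometric_load NE x).
  move=> x0; rewrite /P !hornerE horner_sum mulrBr -exprSr; congr (_ - _).
  rewrite mulrCA; congr (_ * _); rewrite /geometric_load mulr_sumr.
  apply: eq_bigr => i _; rewrite !hornerE exprMn exprVn mulrCA; congr (_ * _).
  have iN : (i <= NE)%N by rewrite -ltnS.
  have -> : x ^+ NE = x ^+ (NE - i) * x ^+ i by rewrite -exprD subnK.
  by rewrite mulfK// expf_neq0// gt_eqF.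
(* At [PG] the sign is nonpositive, since the load is at least 1. As [b >= e], the load at [b] is at
   most [NE.+1], so the sign there is nonnegative. *)
pose b := PG S * NE.+1%:R + e.
have b_gePG : PG S <= b.
  rewrite /b -natr1 mulrDr mulr1 addrAC lerDr addr_ge0 ?(ltW lambdaE_gt0)//.
  by rewrite mulr_ge0// ltW.
have b0 : 0 < b by exact: lt_le_trans b_gePG.
have [|x /andP[xge _]] := @poly_ivt _ P (PG S) b b_gePG.
  rewrite !PE//; apply/andP; split.
    rewrite mulr_ge0_le0 ?exprn_ge0 ?(ltW PG_gt0)// subr_le0.
    rewrite ler_peMr ?(ltW PG_gt0)//.
    exact: geometric_load_ge1.
  rewrite mulr_ge0 ?exprn_ge0 ?(ltW b0)// subr_ge0.
  apply: (@le_trans _ _ (PG S * NE.+1%:R)); last first.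
    by rewrite lerDl (ltW lambdaE_gt0).
  rewrite ler_pM2l// -[in leRHS](card_ord NE.+1) -sumr_const.
  apply: ler_sum => i _.
  rewrite exprn_ile1 ?divr_ge0 ?(ltW lambdaE_gt0) ?(ltW b0)//.
  by rewrite ler_pdivrMr// mul1r lerDr mulr_ge0// ltW.
have x0 : 0 < x by exact: lt_le_trans xge.
rewrite rootE PE// mulf_eq0 expf_eq0 gt_eqF// andbF/= subr_eq0 => /eqP xE.
exists x => //; rewrite pGmaxE// {1}xE mulfK// gt_eqF//.
exact: lt_le_trans ltr01 (geometric_load_ge1 _ x0).
Qed.

(** Existence of a solution is what makes the value of [get] meaningful. *)
Lemma x_starP NE : 0 < x_star S NE /\ pGmax S (x_star S NE) NE = PG S.
Proof.
have [x x0 xE] := pGmax_eq_PG_solvable NE.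
by apply: (@getI _ (grid_solutions S NE) x); split.
Qed.

Lemma grid_solutions_x_star NE : grid_solutions S NE = [set x_star S NE].
Proof.
have [x0 xE] := x_starP NE.
apply/seteqP; split => [y [y0 yE]|y ->]; last by split.
by apply: (@pGmax_inj NE) => //; rewrite yE xE.
Qed.

(** At [x_star S NE] the larger storage costs less than [PG], so its increasing cost reaches [PG]
    further right. *)
Lemma x_star_lt NE NE' : (NE < NE')%N -> x_star S NE < x_star S NE'.
Proof.
move=> NN; have [x0 xE] := x_starP NE; have [y0 yE] := x_starP NE'.
rewrite ltNge -(ler_pGmax NE')// -ltNge yE -xE.
exact: pGmax_lt_storage.
Qed.

(** For [p > 0] the increasing cost turns the budget into [p <= x_star]; at [p = 0] the cost is 0,
    below [PG]. *)
Lemma feasibleE NE p :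
  feasible S NE p <-> 0 <= p /\ p <= Num.min 1 (x_star S NE).
Proof.
have [x0 xE] := x_starP NE; rewrite le_min; split.
  case=> p_ge0 p1 pP; split=> //; rewrite p1 /=.
  move: p_ge0 pP; rewrite le_eqVlt => /predU1P[<- _|p0]; first exact: ltW.
  by rewrite -xE ler_pGmax.
case; rewrite le_eqVlt => /predU1P[<-|p0] /andP[p1 px].
  by split=> //; rewrite pGmax0 ltW.
by split; rewrite ?(ltW p0)// -xE ler_pGmax.
Qed.

(** * The unique maximizer and its dependence on the storage size *)

Section optimum.
Variable Nt : nat.
Hypotheses (lambda_gt0 : 0 < lambda S) (CNt_gt0 : 0 < C S Nt).

Lemma lambdaQmax_lt p q : 0 < q -> p != q ->
  p <= q + q * (C S Nt * lambda S) * (p - q) ->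
  lambdaQmax S p Nt < lambdaQmax S q Nt.
Proof.
move=> q0 pq pleq; have k0 : 0 < C S Nt * lambda S by rewrite mulr_gt0.
have lE x : lambdaQmax S x Nt = x * expR (- (C S Nt * lambda S * x)) *
    expR (- (N0 S / Ptx S * delta S * r1 S `^ alpha S)).
  by rewrite /lambdaQmax expRD mulrA; congr (_ * expR _ * _); ring.
by rewrite !lE ltr_pM2r ?expR_gt0// ltr_mulr_expRN.
Qed.

Definition p_opt NE :=
  Num.min (x_star S NE) (Num.min 1 (1 / (C S Nt * lambda S))).

Lemma p_opt_gt0 NE : 0 < p_opt NE.
Proof.
rewrite /p_opt !lt_min (x_starP NE).1 ltr01 /=.
by rewrite divr_gt0// mulr_gt0.
Qed.

Lemma p_opt_feasible NE : feasible S NE (p_opt NE).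
Proof.
by apply/feasibleE; rewrite ltW ?p_opt_gt0// le_min !ge_min !lexx !orbT.
Qed.

Lemma lambdaQmax_lt_p_opt NE p : feasible S NE p -> p != p_opt NE ->
  lambdaQmax S p Nt < lambdaQmax S (p_opt NE) Nt.
Proof.
move=> /feasibleE[p0 pm] neq_opt.
apply: lambdaQmax_lt => //; first exact: p_opt_gt0.
have k0 : 0 < C S Nt * lambda S by rewrite mulr_gt0.
(* Regrouped as the minimum of the right end [m] of the feasible interval and the free optimum
   [1 / (C * lambda)]. *)
have := neq_opt; rewrite /p_opt minA [Num.min _ 1]minC.
set m := Num.min 1 _ in pm *; rewrite minEle; case: ifPn => [mk pm'|_ _].
  have {pm'} pm' : p < m by rewrite lt_neqAle pm'.
  have mk1 : m * (C S Nt * lambda S) <= 1 by rewrite -ler_pdivlMr.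
  (* When [m] is the optimum, the gap in the tangent bound factors into two nonnegative terms. *)
  rewrite -subr_ge0.
  have -> : m + m * (C S Nt * lambda S) * (p - m) - p =
    (1 - m * (C S Nt * lambda S)) * (m - p) by ring.
  by rewrite mulr_ge0// subr_ge0// ltW.
(* At the free optimum the tangent bound is an equality. *)
by rewrite div1r mulVf ?gt_eqF// mul1r addrC subrK.
Qed.

Lemma maximizers_p_opt NE : maximizers S NE Nt = [set p_opt NE].
Proof.
apply/seteqP; split => [p [pF pmax]|p ->].
  apply/eqP; rewrite -[_ == _]negbK; apply/negP => /(lambdaQmax_lt_p_opt pF).
  by rewrite ltNge pmax//; exact: p_opt_feasible.
split=> [|q qF]; first exact: p_opt_feasible.
have [->//|/(lambdaQmax_lt_p_opt qF)/ltW//] := eqVneq q (p_opt NE).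
Qed.

Lemma ptx_starE NE : ptx_star S NE Nt = p_opt NE.
Proof.
have : maximizers S NE Nt (ptx_star S NE Nt).
  by apply: (@getI _ _ (p_opt NE)); rewrite maximizers_p_opt.
by rewrite maximizers_p_opt.
Qed.

(** The old optimum [x_star S NE] stays feasible for [NE'] but lies strictly below the new, unique
    one. *)
Lemma lambdaQmax_star_lt_storage NE NE' : (NE < NE')%N ->
  x_star S NE < Num.min 1 (1 / (C S Nt * lambda S)) ->
  lambdaQmax_star S NE Nt < lambdaQmax_star S NE' Nt.
Proof.
move=> NN; have xx : x_star S NE < x_star S NE' by exact: x_star_lt.
rewrite /lambdaQmax_star !ptx_starE [p_opt NE]/p_opt.
set M := Num.min 1 _ => xM; rewrite (min_idPl (ltW xM)).
have xo : x_star S NE < p_opt NE' by rewrite /p_opt lt_min xx.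
apply: lambdaQmax_lt_p_opt; last by rewrite lt_eqF.
apply/feasibleE; have [x0 _] := x_starP NE.
rewrite (ltW x0) le_min (ltW xx) andbT; split=> //.
by apply: ltW; apply: lt_le_trans xM _; rewrite ge_min lexx.
Qed.

Lemma lambdaQmax_star_eq_storage NE NE' : (NE < NE')%N ->
  Num.min 1 (1 / (C S Nt * lambda S)) <= x_star S NE ->
  lambdaQmax_star S NE Nt = lambdaQmax_star S NE' Nt.
Proof.
move=> NN Mx; have xx : x_star S NE < x_star S NE' by exact: x_star_lt.
rewrite /lambdaQmax_star !ptx_starE /p_opt.
by rewrite (min_idPr Mx) (min_idPr (le_trans Mx (ltW xx))).
Qed.

End optimum.

(** A smaller [C] already improves the value at the old maximizer, which remains feasible because
    the constraint does not involve [Nt]. *)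
Lemma lambdaQmax_star_lt NE Nt Nt' : 0 < lambda S -> 0 < C S Nt' ->
  C S Nt' < C S Nt -> lambdaQmax_star S NE Nt < lambdaQmax_star S NE Nt'.
Proof.
move=> l0 C'0 CC; have C0 : 0 < C S Nt by exact: lt_trans CC.
apply: (@lt_le_trans _ _ (lambdaQmax S (ptx_star S NE Nt) Nt')).
  by apply: ltr_mulr_expRB => //; rewrite (ptx_starE l0 C0) p_opt_gt0.
have : maximizers S NE Nt' (ptx_star S NE Nt').
  by rewrite (ptx_starE l0 C'0) maximizers_p_opt.
by case=> _; apply; rewrite (ptx_starE l0 C0); exact: p_opt_feasible.
Qed.

Lemma lambdaQmax_star_eq NE Nt Nt' : 0 < lambda S -> 0 < C S Nt ->
  C S Nt = C S Nt' -> lambdaQmax_star S NE Nt = lambdaQmax_star S NE Nt'.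
Proof.
move=> l0 C0 CE; have C'0 : 0 < C S Nt' by rewrite -CE.
rewrite /lambdaQmax_star (ptx_starE l0 C0) (ptx_starE l0 C'0).
by rewrite /p_opt /lambdaQmax CE.
Qed.

End grid_power.

Local Opaque lambdaQmax_star.

Theorem theorem2 (R : realType) (S : network R)
    (lambda_gt0 : 0 < lambda S) (alpha_gt2 : 2 < alpha S)
    (r1_gt0 : 0 < r1 S) (delta_gt0 : 0 < delta S) (Ptx_gt0 : 0 < Ptx S)
    (lambdaE_gt0 : 0 < lambdaE S) (lambdaE_lt1 : lambdaE S < 1)
    (PG_gt0 : 0 < PG S) :
  [/\ (* the solution x* is well defined *)
      (forall NE : nat, (0 < NE)%N ->
         grid_solutions S NE = [set x_star S NE]),
      (* closed form of the unique maximizer *)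
      (forall NE Nt : nat, (0 < NE)%N -> admissible S Nt ->
         maximizers S NE Nt = [set ptx_star S NE Nt] /\
         ptx_star S NE Nt =
           Num.min (x_star S NE) (Num.min 1 (1 / (C S Nt * lambda S)))),
      (* dependence on the storage size *)
      (forall Nt : nat, admissible S Nt ->
         forall NE NE' : nat, (0 < NE)%N -> (NE < NE')%N ->
           (x_star S NE < Num.min 1 (1 / (C S Nt * lambda S)) ->
              lambdaQmax_star S NE Nt < lambdaQmax_star S NE' Nt) /\
           (Num.min 1 (1 / (C S Nt * lambda S)) <= x_star S NE ->
              lambdaQmax_star S NE Nt = lambdaQmax_star S NE' Nt)) &
      (* dependence on the number of antennas *)
      (forall NE : nat, (0 < NE)%N ->
         forall Nt Nt' : nat, admissible S Nt -> admissible S Nt' ->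
           (Nt < Nt')%N ->
           lambdaQmax_star S NE Nt <= lambdaQmax_star S NE Nt' /\
           (lambdaQmax_star S NE Nt < lambdaQmax_star S NE Nt' <->
              coord_factor S Nt' < 1))].
Proof.
have Cp Nt : admissible S Nt -> 0 < C S Nt by exact: C_gt0.
split=> [NE _|NE Nt _ /Cp C0|Nt /Cp C0 NE NE' _ NN|NE _ Nt Nt' adN adN' NN].
- exact: grid_solutions_x_star.
- by rewrite ptx_starE// maximizers_p_opt.
- split; first exact: lambdaQmax_star_lt_storage.
  exact: lambdaQmax_star_eq_storage.
- have strict : coord_factor S Nt' < 1 ->
      lambdaQmax_star S NE Nt < lambdaQmax_star S NE Nt'.
    move=> /(C_lt lambda_gt0 alpha_gt2 r1_gt0 delta_gt0 adN adN' NN) CC.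
    by apply: lambdaQmax_star_lt CC => //; exact: Cp.
  (* Here both constants sit at the cap and the optimal values coincide, so strict growth fails
     exactly in this case. *)
  have const : 1 <= coord_factor S Nt' ->
      lambdaQmax_star S NE Nt = lambdaQmax_star S NE Nt'.
    move=> /(C_eq lambda_gt0 alpha_gt2 r1_gt0 adN NN) CE.
    by apply: lambdaQmax_star_eq CE => //; exact: Cp.
  have [cf1|cf1] := ltP (coord_factor S Nt') 1.
    have lt := strict cf1.
    by split; [exact: ltW|split].
  (* The case split has turned [coord_factor S Nt' < 1] into [false], so the equivalence is between
     two false statements. *)
  rewrite (const cf1) lexx ltxx; exact: (conj isT (iff_refl _)).
Qed.
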